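(* Let $d \geq 3$ and $1 \leq r < \frac{d}{2}$ be integers. Let $\overline{B}_{d,r}(n)$ be the number of overpartitions of $n$ defined in the context, and let $\overline{E}_{d,r}(n)$ denote the number of partitions of $n$ into distinct parts congruent to $\pm r \pmod{d}$ and unrestricted parts divisible by $2d$ (that is, all parts are congruent to $\pm r$ modulo $d$ or divisible by $2d$; parts congruent to $\pm r$ modulo $d$ appear at most once each, while parts divisible by $2d$ may be repeated). Then for all $n \geq 0$, $$\overline{B}_{d,r}(n) = \overline{E}_{d,r}(n).$$
   Context: An overpartition of $n$ is a partition of $n$ (a non-decreasing sequence of positive integer parts $\lambda_1 \le \lambda_2 \le \cdots$ with sum $n$) in which the final occurrence of each integer may be overlined. Use the four symbols $\overline{r}, \overline{d-r}, \overline{d}, d$ for types of parts: a part is said to be $\equiv \overline{r}$ (resp. $\overline{d-r}$, $\overline{d}$) modulo $d$ if it is overlined and its size is congruent to $r$ (resp. $d-r$, $d$) modulo $d$; it is $\equiv d$ modulo $d$ (without overline) if it is non-overlined and its size is divisible by $d$. The same convention (overlined symbol means overlined part, non-overlined symbol means non-overlined part) applies to congruences modulo $2d$. Define the matrix $\overline{A}_{d,r}$, with rows and columns both indexed in order by $\overline{r}, \overline{d-r}, \overline{d}, d$ and with $\overline{A}_{d,r}(u,v)$ the entry in row $u$, column $v$, by $$\overline{A}_{d,r} = \begin{pmatrix} d & 2r & d+r & r \\ 2d-2r & d & 2d-r & d-r \\ 2d-r & d+r & 2d & d \\ d-r & r & d & 0 \end{pmatrix}.$$ For $n \ge 0$,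 $\overline{B}_{d,r}(n)$ is the number of overpartitions $\lambda$ of $n$ into parts congruent to $r$, $d-r$, or $d$ modulo $d$, where only multiples of $d$ may appear non-overlined, such that: (i) the smallest part $\lambda_1$ is congruent to $\overline{r}$, $\overline{d-r}$, $\overline{d}$, or $2d$ modulo $2d$ (i.e. it is overlined with size congruent to $r$, $d-r$ or $d$ modulo $2d$, or non-overlined with size divisible by $2d$); (ii) for $u,v \in \{\overline{r},\overline{d-r},\overline{d},d\}$, if $\lambda_{i+1} \equiv u \pmod d$ and $\lambda_i \equiv v \pmod d$, then $\lambda_{i+1}-\lambda_i \geq \overline{A}_{d,r}(u,v)$; (iii) for $u,v$ as in (ii), if $\lambda_{i+1} \equiv u \pmod d$ and $\lambda_i \equiv v \pmod d$, then $\lambda_{i+1}-\lambda_i \equiv \overline{A}_{d,r}(u,v) \pmod{2d}$. The empty overpartition is counted, so $\overline{B}_{d,r}(0)=1$. *)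

(* Defs.v *)
From mathcomp Require Import all_boot.
Set Implicit Arguments.
Unset Strict Implicit.
Unset Printing Implicit Defensive.

(* A part of an overpartition is a pair (size, overlined?); sequences of parts
   are listed in non-decreasing order of size. *)

Definition is_overpartition (n : nat) (s : seq (nat * bool)) : bool :=
  [&& all (fun p => 0 < p.1) s,
      pairwise (fun p q => p.1 <= q.1) s,
      pairwise (fun p q => p.2 ==> (p.1 != q.1)) s
    & \sum_(p <- s) p.1 == n].

Definition is_partition (n : nat) (s : seq nat) : bool :=
  [&& all (fun x => 0 < x) s, pairwise leq s & \sum_(x <- s) x == n].

Inductive symbol : predArgType := Rbar | DRbar | Dbar | Dplain.

Definition symbols : seq symbol := [:: Rbar; DRbar; Dbar; Dplain].

Definition symbol_residue (d r : nat) (u : symbol) : nat :=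
  match u with Rbar => r | DRbar => d - r | Dbar => d | Dplain => d end.

Definition symbol_overlined (u : symbol) : bool :=
  match u with Dplain => false | _ => true end.

Definition part_congr (p : nat * bool) (a : nat) (o : bool) (m : nat) : bool :=
  (p.1 == a %[mod m]) && (p.2 == o).

Definition part_type (d r : nat) (p : nat * bool) (u : symbol) : bool :=
  part_congr p (symbol_residue d r u) (symbol_overlined u) d.

(* First argument: row (type of the larger part); second argument: column.
   No subtraction truncates when r < d. *)
Definition Abar (d r : nat) (u v : symbol) : nat :=
  match u, v with
  | Rbar,   Rbar => d             | Rbar,   DRbar => 2 * r
  | Rbar,   Dbar => d + r         | Rbar,   Dplain => r
  | DRbar,  Rbar => 2 * d - 2 * r | DRbar,  DRbar => d
  | DRbar,  Dbar => 2 * d - r     | DRbar,  Dplain => d - r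
  | Dbar,   Rbar => 2 * d - r     | Dbar,   DRbar => d + r
  | Dbar,   Dbar => 2 * d         | Dbar,   Dplain => d
  | Dplain, Rbar => d - r         | Dplain, DRbar => r
  | Dplain, Dbar => d             | Dplain, Dplain => 0
  end.

Definition B_part (d r : nat) (p : nat * bool) : bool :=
  [|| p.1 == r %[mod d], p.1 == d - r %[mod d] | p.1 == d %[mod d]]
  && (~~ p.2 ==> (d %| p.1)).

Definition B_smallest (d r : nat) (s : seq (nat * bool)) : bool :=
  match s with
  | [::] => true
  | p :: _ => [|| part_congr p r true (2 * d),
                  part_congr p (d - r) true (2 * d),
                  part_congr p d true (2 * d)
                | part_congr p (2 * d) false (2 * d)]
  end.

Definition B_gap (d r : nat) (p q : nat * bool) : bool :=
  all (fun u => all (fun v =>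
    part_type d r q u && part_type d r p v ==> (Abar d r u v <= q.1 - p.1))
  symbols) symbols.

Definition B_gap_congr (d r : nat) (p q : nat * bool) : bool :=
  all (fun u => all (fun v =>
    part_type d r q u && part_type d r p v ==>
      (q.1 - p.1 == Abar d r u v %[mod 2 * d]))
  symbols) symbols.

Definition B_cond (d r n : nat) (s : seq (nat * bool)) : bool :=
  [&& is_overpartition n s, all (B_part d r) s, B_smallest d r s,
      sorted (B_gap d r) s & sorted (B_gap_congr d r) s].

Definition congr_pm (d r x : nat) : bool :=
  (x == r %[mod d]) || (x == d - r %[mod d]).

Definition E_cond (d r n : nat) (s : seq nat) : bool :=
  [&& is_partition n s,
      all (fun x => congr_pm d r x || (2 * d %| x)) s
    & all (fun x => congr_pm d r x ==> (count_mem x s <= 1)) s].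

(* Every (over)partition of n has at most n parts, each of size at most n, so
   it is the image of exactly one bounded sequence: see overpartition_bseq and
   partition_bseq below. *)
Definition parts_of_bseq (n : nat) (t : n.-bseq ('I_n.+1 * bool)) :
    seq (nat * bool) :=
  [seq (val p.1, p.2) | p <- t].

Definition sizes_of_bseq (n : nat) (t : n.-bseq 'I_n.+1) : seq nat :=
  [seq val x | x <- t].

Definition Bbar (d r n : nat) : nat :=
  #|[set t : n.-bseq ('I_n.+1 * bool) | B_cond d r n (parts_of_bseq t)]|.

Definition Ebar (d r n : nat) : nat :=
  #|[set t : n.-bseq 'I_n.+1 | E_cond d r n (sizes_of_bseq t)]|.

Lemma parts_of_bseq_inj n : injective (@parts_of_bseq n).
Proof.
move=> s t /inj_map st; apply/val_inj/st => -[i b] [j c] /= [ij ->].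
by congr (_, _); apply: val_inj.
Qed.

Lemma sizes_of_bseq_inj n : injective (@sizes_of_bseq n).
Proof. by move=> s t /(inj_map val_inj) /val_inj. Qed.

Lemma size_le_sum (T : Type) (f : T -> nat) (s : seq T) :
  all (fun x => 0 < f x) s -> size s <= \sum_(x <- s) f x.
Proof.
elim: s => //= x s IH /andP[x0 s0]; rewrite big_cons -add1n.
by apply: leq_add => //; apply: IH.
Qed.

Lemma all_le_sum (T : Type) (f : T -> nat) (s : seq T) :
  all (fun x => f x <= \sum_(y <- s) f y) s.
Proof.
elim: s => //= x s IH; rewrite big_cons leq_addr /=.
by apply: sub_all IH => y /leq_trans; apply; rewrite leq_addl.
Qed.

Lemma overpartition_bseq n s :
  is_overpartition n s -> exists t : n.-bseq ('I_n.+1 * bool), parts_of_bseq t = s.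
Proof.
case/and4P=> s0 _ _ /eqP sn.
have := size_le_sum s0; rewrite sn => sz.
have := all_le_sum fst s; rewrite sn => le.
have szm : size [seq (inord p.1 : 'I_n.+1, p.2) | p <- s] <= n by rewrite size_map.
exists (Bseq szm); rewrite /parts_of_bseq /= -map_comp -[RHS]map_id.
elim: s le {s0 sn sz szm} => //= -[i b] s IH /andP[/= le /IH->].
by rewrite inordK.
Qed.

Lemma partition_bseq n s :
  is_partition n s -> exists t : n.-bseq 'I_n.+1, sizes_of_bseq t = s.
Proof.
case/and3P=> s0 _ /eqP sn.
have := size_le_sum s0; rewrite sn => sz.
have := all_le_sum id s; rewrite sn => le.
have szm : size [seq (inord x : 'I_n.+1) | x <- s] <= n by rewrite size_map.
exists (Bseq szm); rewrite /sizes_of_bseq /= -map_comp -[RHS]map_id.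
elim: s le {s0 sn sz szm} => //= i s IH /andP[/= le /IH->].
by rewrite inordK.
Qed.

(* Main.v *)
(** The matrix splits as [Abar u v = f u + g v]. Read the parts of an
    overpartition from the largest, [l_1 >= l_2 >= ...], padded with
    non-overlined zeros, let [u_j] be the type of [l_j], and write
    [l_j - l_(j+1) = f u_j + g u_(j+1) + 2 d k_j]. Summation by parts gives
    [sum_j l_j = sum_j (j f u_j + (j-1) g u_j + 2 d j k_j)], and
    [j f u + (j-1) g u] is [(j-1) d + r], [(j-1) d + (d-r)], the sum of these
    two, or [0], according to [u]. So [u_j] records which of the parts
    [(j-1) d + r] and [(j-1) d + (d-r)] occur in a partition counted by [Ebar],
    and [k_j] is the multiplicity of its part [2 d j]. *)

Require Import Defs.
From mathcomp Require Import all_boot zify.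
Set Implicit Arguments.
Unset Strict Implicit.
Unset Printing Implicit Defensive.

(** A choice function for [R] on [A] is injective. Working with a relation lets bounded sequences be
    matched through a common code, with no map written between the two bounded types. *)
Lemma leq_card_rel (X Y : finType) (A : {set X}) (B : {set Y})
    (R : X -> Y -> Prop) :
  (forall x, x \in A -> exists2 y, y \in B & R x y) ->
  (forall x x' y, R x y -> R x' y -> x = x') -> #|A| <= #|B|.
Proof.
move=> AB Rinj.
have /fin_all_exists[f fP] : forall x : {x | x \in A},
    exists y : {y | y \in B}, R (val x) (val y).
  by case=> x /= /AB[y By Rxy]; exists (exist _ y By).
have := @leq_card _ _ f; rewrite !card_sig; apply=> x x' ff.
by apply/val_inj/(Rinj _ _ (val (f x))); [exact: fP | rewrite ff; exact: fP].
Qed.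

Lemma modn_eqE (m a x : nat) :
  a < m -> x = a %[mod m] -> exists k, x = a + k * m.
Proof.
move=> am; rewrite (modn_small am) => xa; exists (x %/ m).
by rewrite {1}(divn_eq x m) xa addnC.
Qed.

(** The two bits tell whether [r] and [d - r] enter the residue of the type: both for [Dbar], as
    they add up to [d], and neither for [Dplain]. *)
Definition sym (u : bool * bool) : symbol :=
  match u with
  | (true, false) => Rbar | (false, true) => DRbar
  | (true, true) => Dbar  | (false, false) => Dplain
  end.

(* [((a, b), k)] at index [j - 1] stands for [u_j = sym (a, b)] and [k_j = k]. *)
Notation code := (seq (bool * bool * nat)).
Notation code0 := (false, false, 0).

(** A code stands for a finitely supported sequence, which trailing [code0] entries would represent
    in several ways. The default of [last] differs from [code0], so that the empty code is
    trimmed. *)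
Definition trimmed (c : code) : bool := last (true, true, 0) c != code0.

Lemma trimmed_cons x c :
  trimmed (x :: c) = if c is [::] then x != code0 else trimmed c.
Proof. by case: c. Qed.

Lemma trimmed_ext (c c' : code) : trimmed c -> trimmed c' ->
  (forall j, nth code0 c j = nth code0 c' j) -> c = c'.
Proof.
move=> tc tc' cc.
have le (e e' : code) : trimmed e' -> (forall j, nth code0 e j = nth code0 e' j) ->
    size e' <= size e.
  case/lastP: e' => // e' y; rewrite /trimmed last_rcons size_rcons => y0 ee.
  rewrite ltnNge; apply: contraNN y0 => le.
  by move: (ee (size e')); rewrite nth_rcons ltnn eqxx nth_default // => <-.
apply: (@eq_from_nth _ code0) => [|j _]; last exact: cc.
by apply/eqP; rewrite eqn_leq !le.
Qed.

Section Bijection.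

Variables (d r : nat).
Hypotheses (hr1 : 1 <= r) (hr2 : 2 * r < d).

(** * Splitting of the matrix, and uniqueness of types *)

Let f (u : bool * bool) : nat := u.1 * r + u.2 * (d - r).
Let g (u : bool * bool) : nat := u.1 * (d - r) + u.2 * r.

Let fg u : f u + g u = (u.1 + u.2) * d.
Proof. by case: u => [] [] []; rewrite /f /g /=; lia. Qed.

Lemma Abar_split u v : Abar d r (sym u) (sym v) = f u + g v.
Proof. by case: u v => [] [] [] [] [] []; rewrite /f /g /=; lia. Qed.

Lemma part_type_sym p u :
  part_type d r p (sym u) = (p.1 == f u %[mod d]) && (p.2 == (u.1 || u.2)).
Proof.
case: u => [] [] [];
  rewrite /part_type /part_congr /f /= ?mul1n ?mul0n ?add0n ?addn0 ?mod0n ?modnn //.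
by rewrite subnKC ?modnn //; lia.
Qed.

(** Since [0 < r < d - r < d], the residues [0], [r], [d - r] differ; the overline separates [Dbar]
    from [Dplain], both of residue [0]. *)
Lemma part_type_inj p u v :
  part_type d r p (sym u) -> part_type d r p (sym v) -> u = v.
Proof.
rewrite !part_type_sym => /andP[/eqP-> /eqP->] /andP[].
have d0 : (r + (d - r)) %% d = 0 by rewrite subnKC ?modnn //; lia.
have r0 : r %% d = r by apply: modn_small; lia.
have s0 : (d - r) %% d = d - r by apply: modn_small; lia.
by case: u v => [] [] [] [] [] [] //=;
  rewrite /f /= ?mul1n ?mul0n ?add0n ?addn0 ?mod0n ?d0 ?r0 ?s0 => /eqP; lia.
Qed.

Lemma B_partP p : reflect (exists u, part_type d r p (sym u)) (B_part d r p).
Proof.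
have dvd m : (d %| m) = (m == d %[mod d]) by rewrite modnn.
rewrite /B_part dvd; apply: (iffP andP) => [[pm pp]|[u]].
- case: (boolP p.2) pp => /= p2 => [_|pp].
    case/or3P: pm => pd;
      [exists (true, false) | exists (false, true) | exists (true, true)];
      by rewrite /part_type /part_congr pd p2.
  by exists (false, false); rewrite /part_type /part_congr pp (negPf p2).
- by case: u => [] [] []; rewrite /part_type /part_congr => /andP[/= -> /eqP->];
    rewrite ?orbT.
Qed.

Lemma all_symbolsP (P : pred symbol) : reflect (forall u, P (sym u)) (all P symbols).
Proof.
apply: (iffP and5P) => [[? ? ? ? _] [] [] [] //|H].
by split=> //; [exact: (H (true, false)) | exact: (H (false, true)) |
  exact: (H (true, true)) | exact: (H (false, false))].
Qed.

Lemma all_typesE (P : symbol -> symbol -> bool) p q u v :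
  part_type d r q (sym u) -> part_type d r p (sym v) ->
  all (fun u => all (fun v => part_type d r q u && part_type d r p v ==> P u v)
    symbols) symbols = P (sym u) (sym v).
Proof.
move=> qu pv; apply/all_symbolsP/idP => [/(_ u) /all_symbolsP /(_ v)|Puv u'].
  by rewrite qu pv.
apply/all_symbolsP => v'; apply/implyP => /andP[qu' pv'].
by rewrite -(part_type_inj qu qu') -(part_type_inj pv pv').
Qed.

(** * The conditions on overpartitions as a recursion from the largest part *)

Let step (q p : nat * bool) : bool :=
  [&& p.1 <= q.1, B_gap d r p q & B_gap_congr d r p q].

(** The lower bound on the gap makes the quotient [k] in the congruence modulo [2 * d] a natural
    number. *)
Lemma stepP p q u v :
  part_type d r q (sym u) -> part_type d r p (sym v) ->
  reflect (exists k, q.1 = p.1 + (f u + g v) + 2 * d * k) (step q p).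
Proof.
move=> qu pv; rewrite /step /B_gap /B_gap_congr.
rewrite (all_typesE (fun u v => Abar d r u v <= q.1 - p.1) qu pv).
rewrite (all_typesE (fun u v => q.1 - p.1 == Abar d r u v %[mod 2 * d]) qu pv).
rewrite Abar_split; apply: (iffP and3P) => [[pq le]|[k ->]].
  by rewrite eqn_mod_dvd // => /dvdnP[k kE]; exists k; lia.
rewrite -addnA addKn !leq_addr; split=> //.
by rewrite [2 * d * k]mulnC addnC modnMDl.
Qed.

(** Only [Dplain] has [g v = 0], so the gap above an overlined part is positive: the overlining rule
    follows from the gap conditions. *)
Lemma step_overlined q p :
  B_part d r q -> B_part d r p -> step q p -> p.2 ==> (p.1 != q.1).
Proof.
move=> /B_partP[u qu] /B_partP[v pv] /(stepP qu pv)[k ->].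
apply/implyP => p2; suff : 0 < g v by lia.
by move: pv; rewrite part_type_sym p2 => /andP[_]; case: v => [] [] [] //=;
  rewrite /g /=; lia.
Qed.

(* [t] lists the parts from the largest to the smallest. *)
Let good (t : seq (nat * bool)) : bool :=
  [&& all (fun p => (0 < p.1) && B_part d r p) t, B_smallest d r (rev t)
    & sorted step t].

Lemma B_cond_rev n t :
  B_cond d r n (rev t) = good t && (\sum_(p <- t) p.1 == n).
Proof.
rewrite /B_cond /is_overpartition /good !all_rev.
have -> : all (fun p => (0 < p.1) && B_part d r p) t =
    all (fun p => 0 < p.1) t && all (B_part d r) t by exact: all_predI.
rewrite (perm_big t) /=; last by rewrite perm_rev.
have -> : sorted step t = [&& sorted (fun p q => p.1 <= q.1) (rev t),
    sorted (B_gap d r) (rev t) & sorted (B_gap_congr d r) (rev t)].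
  by rewrite !rev_sorted -!sorted_relI.
case: (boolP (all (B_part d r) t)) => [tB|]; last by rewrite !andbF.
case: (boolP (all _ t)) => //= _.
set S := \sum_(p <- t) p.1 == n; set s0 := B_smallest _ _ _.
set G := sorted (B_gap d r) _; set H := sorted (B_gap_congr d r) _.
have le_trans : transitive (fun p q : nat * bool => p.1 <= q.1).
  by move=> q p s; exact: leq_trans.
rewrite (sorted_pairwise le_trans).
set L := pairwise _ _.
suff imp : [&& L, G & H] -> pairwise (fun p q => p.2 ==> (p.1 != q.1)) (rev t).
  case: (boolP [&& L, G & H]) imp => [/and3P[-> -> ->] -> //|].
    by rewrite !andbT andbC.
  by case: L G H => [] [] [] //= _ _; rewrite ?andbF.
(* The overlining rule alone is not transitive; joined to the order of sizes it is, and so passes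
   from neighbours to all pairs. *)
move=> LGH; pose R (p q : nat * bool) := (p.1 <= q.1) && (p.2 ==> (p.1 != q.1)).
have Rtr : transitive R.
  move=> q p s /andP[pq pq'] /andP[qs _]; rewrite /R (leq_trans pq qs) /=.
  apply/implyP => p2; move: pq'; rewrite p2 => /=; clear -pq qs; lia.
suff : pairwise R (rev t) by rewrite pairwise_relI => /andP[].
rewrite -(sorted_pairwise Rtr) rev_sorted.
apply: (@sub_in_sorted _ (B_part d r) step) _ tB _.
  move=> q p qB pB qp; rewrite /R step_overlined // andbT.
  by case/and3P: qp.
by move: LGH; rewrite /L /G /H -(sorted_pairwise le_trans) !rev_sorted -!sorted_relI.
Qed.

Let part0 : nat * bool := (0, false).

Let part0_type : part_type d r part0 (sym (false, false)).
Proof. by rewrite part_type_sym /f /= addn0 !eqxx. Qed.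

(** As [g (false, false) = 0], the right-hand side is a step down to [part0]: the condition on the
    smallest part is a gap condition against the padding. *)
Lemma B_smallest1P q u : part_type d r q (sym u) -> 0 < q.1 ->
  reflect (exists k, q.1 = f u + 2 * d * k) (B_smallest d r [:: q]).
Proof.
move=> qu q0; apply: (iffP idP) => [|[k qE]].
- have aux v a : q.1 == a %[mod 2 * d] -> a < 2 * d -> a = f v ->
      q.2 == (v.1 || v.2) -> exists k, q.1 = f u + 2 * d * k.
    move=> /eqP qa ad av qv; have [k kE] := modn_eqE ad qa; exists k.
    have -> : u = v.
      apply: part_type_inj qu _; rewrite part_type_sym qv andbT kE av.
      by rewrite mulnA addnC modnMDl.
    by rewrite kE av mulnC.
  rewrite /B_smallest /part_congr => /or4P[] /andP[qa q2].
  + by apply: (aux (true, false) r) => //=; rewrite /f /=; lia.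
  + by apply: (aux (false, true) (d - r)) => //=; rewrite /f /=; lia.
  + by apply: (aux (true, true) d) => //=; rewrite /f /=; lia.
  (* The residue [2 * d] is replaced by [0 = f (false, false)], since [aux] wants a representative
     below [2 * d]. *)
  + have q0' : q.1 == 0 %[mod 2 * d] by move: qa; rewrite modnn mod0n.
    by apply: (aux (false, false) 0 q0' _ _ q2) => //; lia.
- move: qu; rewrite part_type_sym => /andP[_ /eqP q2].
  rewrite /B_smallest /part_congr q2 qE [2 * d * k]mulnC addnC !modnMDl.
  case: u {q2 qE} => [] [] [];
    rewrite /f /= ?mul1n ?mul0n ?add0n ?addn0 ?mod0n ?modnn ?eqxx ?orbT //=.
  by rewrite subnKC ?eqxx ?orbT //; lia.
Qed.

Lemma good_consP q t u v :
  part_type d r q (sym u) -> part_type d r (head part0 t) (sym v) ->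
  reflect [/\ 0 < q.1, good t
            & exists k, q.1 = (head part0 t).1 + (f u + g v) + 2 * d * k]
          (good (q :: t)).
Proof.
move=> qu tv.
have qB : B_part d r q by apply/B_partP; exists u.
case: t tv => [|p t] /= tv.
  have -> : v = (false, false) := part_type_inj tv part0_type.
  rewrite /good /= qB !andbT add0n addn0.
  case: (boolP (0 < q.1)) => /= q0; last by constructor; case.
  by apply: (iffP (B_smallest1P qu q0)) => [|[]].
have -> : good [:: q, p & t] = [&& 0 < q.1, good (p :: t) & step q p].
  rewrite /good; have -> : B_smallest d r (rev [:: q, p & t]) = B_smallest d r (rev (p :: t)).
    by rewrite !rev_cons; case: (rev t).
  by rewrite /= qB andbT; case: (step q p); rewrite ?andbT ?andbF //= -?andbA.
by apply: (iffP and3P) => -[q0 gt] /(stepP qu tv).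
Qed.

(** * From codes to overpartitions *)

Fixpoint overpartition_of (c : code) : seq (nat * bool) :=
  if c is x :: c' then
    ((head part0 (overpartition_of c')).1 + (f x.1 + g (head code0 c').1)
       + 2 * d * x.2, x.1.1 || x.1.2) :: overpartition_of c'
  else [::].

(** The part below has residue [f v], and [f v + g v] is a multiple of [d], so adding [f x.1 + g v]
    leaves the residue [f x.1]. *)
Lemma overpartition_of_type c :
  part_type d r (head part0 (overpartition_of c)) (sym (head code0 c).1).
Proof.
elim: c => [|x c IH] /=; first exact: part0_type.
rewrite part_type_sym eqxx andbT /=; move: IH; rewrite part_type_sym => /andP[/eqP IH _].
set h := (head _ _).1 in IH *; set v := (head _ _).1 in IH *.
have -> : h + (f x.1 + g v) + 2 * d * x.2 = 2 * x.2 * d + (h + g v + f x.1) by lia.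
by rewrite modnMDl -modnDml -(modnDml h) IH (modnDml (f v)) fg modnMl add0n.
Qed.

(** Trimming serves positivity: the last entry is not [code0], so the smallest part is positive, and
    the others are at least as large. *)
Lemma overpartition_of_good c : trimmed c -> good (overpartition_of c).
Proof.
elim: c => [//|x c IH]; rewrite trimmed_cons => xc.
have hx := overpartition_of_type (x :: c).
apply/(good_consP hx (overpartition_of_type c)); split; last by exists x.2.
- case: c xc IH {hx} => [|y c] /= xc.
    by case: x xc => [[[] []] [|k]] //= _ _; rewrite /f /=; lia.
  by move=> /(_ xc) /and3P[/= /andP[/andP[+ _] _] _ _]; lia.
- by case: c xc IH {hx} => // y c xc; apply.
Qed.

Lemma overpartition_of_surj t :
  good t -> exists2 c, trimmed c & overpartition_of c = t.
Proof.
elim: t => [|q t IH] gqt; first by exists [::].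
have /and3P[/= /andP[/andP[_ /B_partP[u qu]] tB] _ _] := gqt.
have [v tv] : exists v, part_type d r (head part0 t) (sym v).
  case: t tB {IH gqt} => [_|p t /andP[/andP[_ /B_partP//]]].
  by exists (false, false).
have /(good_consP qu tv)[q0 /IH[c tc ct] [k qE]] := gqt.
have vE : v = (head code0 c).1.
  by apply: part_type_inj tv _; rewrite -ct; exact: overpartition_of_type.
exists ((u, k) :: c).
  (* Only above the empty code can the new entry break trimming, and there [code0] would give a part
     of size [0]. *)
  rewrite trimmed_cons; case: c tc ct vE => // _ /= ct vE.
  apply/eqP => -[uE kE]; move: q0; rewrite qE -ct vE uE kE /f /g /=; lia.
move: qu; rewrite part_type_sym => /andP[_ /eqP qu].
by rewrite /= ct -vE -qE -qu -surjective_pairing.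
Qed.

(** The type of a part determines [u], then its distance to the next part determines [k]; a trailing
    [code0] is visible as a part of size [0]. *)
Lemma overpartition_of_inj : injective overpartition_of.
Proof.
elim=> [|x c IH] [|y c'] // xy; have cc : c = c' by apply: IH; case: xy.
rewrite -{c'}cc in xy *; congr (_ :: _).
have xyu : x.1 = y.1.
  apply: part_type_inj (overpartition_of_type (x :: c)) _.
  by rewrite xy; exact: (overpartition_of_type (y :: c)).
case: xy; rewrite xyu => /eqP + _; rewrite eqn_add2l eqn_pmul2l; last by lia.
by case: x y xyu => u k [v l] /= -> /eqP->.
Qed.

(** * From codes to partitions *)

Let block (i : nat) (x : bool * bool * nat) : seq nat :=
  nseq x.1.1 (r + i * d) ++ nseq x.1.2 (d - r + i * d) ++ nseq x.2 (2 * d * i.+1).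

Fixpoint partition_of (i : nat) (c : code) : seq nat :=
  if c is x :: c' then block i x ++ partition_of i.+1 c' else [::].

(** Summation by parts, with an offset for the induction: the first summand is what the current
    head, with the [g] of its type, contributes to [i] parts above it. *)
Lemma sum_overpartition_of i c :
  i * ((head part0 (overpartition_of c)).1 + g (head code0 c).1)
    + \sum_(p <- overpartition_of c) p.1 = \sum_(x <- partition_of i c) x.
Proof.
elim: c i => [|[[a b] k] c IH] i; first by rewrite /= !big_nil /g /=; lia.
rewrite /= big_cons !big_cat -IH /= !big_nseq !iter_addn_0.
set h := (head _ _).1; set v := g _; rewrite /f /g /=.
rewrite -/(g (head code0 c).1).
case: a b => [] []; lia.
Qed.

Lemma partition_of_class i c x : x \in partition_of i c ->
  exists j, [\/ x = r + j * d, x = d - r + j * d | x = 2 * d * j.+1].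
Proof.
elim: c i => //= y c IH i; rewrite !mem_cat !mem_nseq => /orP[/or3P[]|/IH//];
  by move=> /andP[_ /eqP->]; exists i; constructor.
Qed.

(** The value [x] occurs only in block [j], and [v] reads its multiplicity off the entry;
    [v code0 = 0] handles indices past the end of the code. *)
Lemma count_partition_of x j (v : bool * bool * nat -> nat) i c :
  v code0 = 0 -> (forall i y, count_mem x (block i y) = (i == j) * v y) ->
  count_mem x (partition_of i c) = if i <= j then v (nth code0 c (j - i)) else 0.
Proof.
move=> v0 xv; elim: c i => [|y c IH] i /=; first by rewrite nth_nil v0 if_same.
rewrite count_cat xv IH; case: (ltngtP i j) => ij.
- by rewrite mul0n (_ : j - i = (j - i.+1).+1) //; lia.
- by rewrite mul0n.
- by rewrite ij subnn mul1n addn0.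
Qed.

(** Uniqueness of Euclidean division, used to tell the three kinds of parts apart, [2 * d * j.+1]
    having residue [0]. *)
Let res x y i j : x < d -> y < d -> (x + i * d == y + j * d) = (x == y) && (i == j).
Proof.
move=> xd yd; apply/eqP/andP => [xy|[/eqP-> /eqP-> //]].
have := congr1 (modn^~ d) xy; have := congr1 (divn^~ d) xy.
by rewrite /= !(addnC _ (_ * d)) !modnMDl !divnMDl ?(divn_small, modn_small); lia.
Qed.

Lemma count_block_r j i y : count_mem (r + j * d) (block i y) = (i == j) * y.1.1.
Proof.
rewrite !count_cat !count_nseq /= (_ : 2 * d * i.+1 = 0 + (2 * i.+1) * d); last by lia.
by rewrite !res; lia.
Qed.

Lemma count_block_dr j i y : count_mem (d - r + j * d) (block i y) = (i == j) * y.1.2.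
Proof.
rewrite !count_cat !count_nseq /= (_ : 2 * d * i.+1 = 0 + (2 * i.+1) * d); last by lia.
by rewrite !res; lia.
Qed.

Lemma count_block_d j i y : count_mem (2 * d * j.+1) (block i y) = (i == j) * y.2.
Proof.
rewrite !count_cat !count_nseq /= !(_ : forall i, 2 * d * i.+1 = 0 + (2 * i.+1) * d); try lia.
by rewrite !res; lia.
Qed.

Lemma count_partition_of_r j c :
  count_mem (r + j * d) (partition_of 0 c) = (nth code0 c j).1.1.
Proof.
by rewrite (@count_partition_of _ j (fun y => y.1.1)) ?subn0 //; exact: count_block_r.
Qed.

Lemma count_partition_of_dr j c :
  count_mem (d - r + j * d) (partition_of 0 c) = (nth code0 c j).1.2.
Proof.
by rewrite (@count_partition_of _ j (fun y => y.1.2)) ?subn0 //; exact: count_block_dr.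
Qed.

Lemma count_partition_of_d j c :
  count_mem (2 * d * j.+1) (partition_of 0 c) = (nth code0 c j).2.
Proof.
by rewrite (@count_partition_of _ j (fun y => y.2)) ?subn0 //; exact: count_block_d.
Qed.

Lemma congr_pmP x :
  reflect (exists j, x = r + j * d \/ x = d - r + j * d) (congr_pm d r x).
Proof.
apply: (iffP orP) => [[]|[j []->]].
- by case/eqP/modn_eqE => [|j]; [lia | exists j; left].
- by case/eqP/modn_eqE => [|j]; [lia | exists j; right].
- by left; rewrite addnC modnMDl.
- by right; rewrite addnC modnMDl.
Qed.

Lemma partition_of_E c n : \sum_(x <- partition_of 0 c) x = n ->
  E_cond d r n (sort leq (partition_of 0 c)).
Proof.
move=> cn; have pc := permEl (perm_sort leq (partition_of 0 c)).
rewrite /E_cond /is_partition -(sorted_pairwise leq_trans).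
rewrite (sort_sorted leq_total) (perm_big _ pc) /= cn eqxx !(perm_all _ pc) andbT.
apply/and3P; split; apply/allP => x /partition_of_class[j].
- by case=> ->; lia.
- case=> ->; first by apply/orP; left; apply/congr_pmP; exists j; left.
  + by apply/orP; left; apply/congr_pmP; exists j; right.
  + by rewrite dvdn_mulr ?orbT.
- move=> _; rewrite (permP pc); apply/implyP => /congr_pmP[i [->|->]].
  + by rewrite count_partition_of_r leq_b1.
  + by rewrite count_partition_of_dr leq_b1.
Qed.

(** Multiplicities recover every entry of the code, and trimming recovers its length. *)
Lemma partition_of_inj c c' : trimmed c -> trimmed c' ->
  sort leq (partition_of 0 c) = sort leq (partition_of 0 c') -> c = c'.
Proof.
move=> tc tc' cc; apply: trimmed_ext => // j.
have /permP cnt : perm_eq (partition_of 0 c) (partition_of 0 c').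
  by apply/(perm_sortP leq_total leq_trans anti_leq).
have := cnt (pred1 (r + j * d)); rewrite !count_partition_of_r.
have := cnt (pred1 (d - r + j * d)); rewrite !count_partition_of_dr.
have := cnt (pred1 (2 * d * j.+1)); rewrite !count_partition_of_d.
by case: (nth _ c j) (nth _ c' j) => [[[] []] k] [[[] []] l] //= ->.
Qed.

Lemma trim_partition_of c : exists2 c', trimmed c' &
  forall i, partition_of i c' = partition_of i c.
Proof.
elim/last_ind: c => [|c x [c' tc' cc']]; first by exists [::].
have [->|x0] := eqVneq x code0; last by exists (rcons c x); rewrite // /trimmed last_rcons.
exists c' => // i; rewrite cc' {cc'}; elim: c i => //= y c IH i; by rewrite IH.
Qed.

Lemma partition_of_surj n s : E_cond d r n s ->
  exists2 c, trimmed c & sort leq (partition_of 0 c) = s.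
Proof.
case/and3P=> /and3P[s0 s_sorted /eqP sn] sE s1.
(* Length [n] suffices: for [j >= n] all three candidate parts exceed [n]. *)
pose c := mkseq (fun j => (r + j * d \in s, d - r + j * d \in s,
  count_mem (2 * d * j.+1) s)) n.
have [c' tc' cc'] := trim_partition_of c; exists c' => //; rewrite cc'.
have le_n x : x \in s -> x <= n.
  by have := all_le_sum id s; rewrite sn => /allP; apply.
have nthc j : nth code0 c j = (r + j * d \in s, d - r + j * d \in s,
  count_mem (2 * d * j.+1) s).
  have [jn|nj] := ltnP j n; first by rewrite nth_mkseq.
  rewrite nth_default ?size_mkseq //.
  have nj' : n <= j * d by apply: leq_trans nj _; rewrite leq_pmulr; lia.
  have no x : n < x -> (x \in s = false) * (count_mem x s = 0).
    move=> nx; have xs : x \notin s by apply: contraL nx => /le_n; lia.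
    by rewrite (negPf xs) (count_memPn xs).
  by rewrite !no //; lia.
(* Distinctness lets a single bit record the multiplicity of such a part. *)
have mem1 x : congr_pm d r x -> count_mem x s = (x \in s).
  move=> xd; case: (boolP (x \in s)) => [xs|/count_memPn//].
  apply/eqP; rewrite eqn_leq -has_count has_pred1 xs andbT.
  by move/allP/(_ x xs): s1; rewrite xd.
rewrite -[RHS](sorted_sort leq_trans); last by rewrite (sorted_pairwise leq_trans).
apply/perm_sortP; [exact: leq_total | exact: leq_trans | exact: anti_leq |].
apply/allP => x; rewrite mem_cat => xcs.
have [j] : exists j, [\/ x = r + j * d, x = d - r + j * d | x = 2 * d * j.+1].
  case/orP: xcs => [/partition_of_class//|xs].
  have /orP[/congr_pmP[j [->|->]]|/dvdnP[[|j] xE]] := allP sE x xs.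
  - by exists j; constructor.
  - by exists j; constructor.
  - by move/allP/(_ x xs): s0; rewrite xE.
  - by exists j; constructor; rewrite mulnC.
case=> -> /=.
- rewrite count_partition_of_r nthc [eqbRHS]mem1 //.
  by apply/congr_pmP; exists j; left.
- rewrite count_partition_of_dr nthc [eqbRHS]mem1 //.
  by apply/congr_pmP; exists j; right.
- by rewrite count_partition_of_d nthc.
Qed.

(** * Equality of the two counts *)

Let corresponds (s : seq (nat * bool)) (s' : seq nat) : Prop :=
  exists2 c, trimmed c &
    s = rev (overpartition_of c) /\ s' = sort leq (partition_of 0 c).

Let sum_codes c :
  \sum_(p <- overpartition_of c) p.1 = \sum_(x <- partition_of 0 c) x.
Proof. by rewrite -sum_overpartition_of mul0n. Qed.

(** Each inequality takes a code from the surjectivity of one of the two maps and concludes by the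
    injectivity of the other. *)
Lemma Bbar_Ebar n : Bbar d r n = Ebar d r n.
Proof.
apply/eqP; rewrite eqn_leq; apply/andP; split.
- apply: (@leq_card_rel _ _ _ _
    (fun t t' => corresponds (parts_of_bseq t) (sizes_of_bseq t'))) => [t|t1 t2 t'].
  + rewrite inE -[parts_of_bseq t]revK B_cond_rev => /andP[gt /eqP sn].
    have [c tc ct] := overpartition_of_surj gt.
    have cE : E_cond d r n (sort leq (partition_of 0 c)).
      by apply: partition_of_E; rewrite -sum_codes ct.
    have [t' t'E] : exists t' : n.-bseq 'I_n.+1,
        sizes_of_bseq t' = sort leq (partition_of 0 c).
      by apply: partition_bseq; case/and3P: cE.
    by exists t'; [rewrite inE t'E | exists c; rewrite // ct revK].
  + move=> [c1 tc1 [t1E ->]] [c2 tc2 [t2E /(partition_of_inj tc1 tc2) cc]].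
    by apply: parts_of_bseq_inj; rewrite t1E t2E cc.
- apply: (@leq_card_rel _ _ _ _
    (fun t' t => corresponds (parts_of_bseq t) (sizes_of_bseq t'))) => [t'|t1 t2 t].
  + rewrite inE => tE; have [c tc ct] := partition_of_surj tE.
    have cB : B_cond d r n (rev (overpartition_of c)).
      rewrite B_cond_rev overpartition_of_good //= sum_codes.
      rewrite -(perm_big _ (permEl (perm_sort leq _))) /= ct.
      by case/and3P: tE => /and3P[].
    have [t tB] : exists t : n.-bseq ('I_n.+1 * bool),
        parts_of_bseq t = rev (overpartition_of c).
      by apply: overpartition_bseq; case/and5P: cB.
    by exists t; [rewrite inE tB | exists c].
  + move=> [c1 _ [-> t1E]] [c2 _ [/(can_inj revK)/overpartition_of_inj cc t2E]].
    by apply: sizes_of_bseq_inj; rewrite t1E t2E cc.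
Qed.

End Bijection.

Theorem corollary1p2 (d r : nat) (hd : 3 <= d) (hr1 : 1 <= r)
    (hr2 : 2 * r < d) (n : nat) :
  Bbar d r n = Ebar d r n.
Proof. exact: Bbar_Ebar. Qed.
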